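(* Any uncountable compact Hausdorff space $X$ with a unique non-isolated point is not openly generated but is an absolute $F$-valued retract for the functor $F$ assigning to each compact Hausdorff space $Z$ the space $F(Z)$ of all functionals $\mu:C(Z)\to\mathbb R$ that preserve constants, are weakly multiplicative, weakly additive, weakly preserve order, and are $3$-Lipschitz. Consequently, for this functor the class of absolute $F$-valued retracts is not contained in the class of openly generated compact Hausdorff spaces.
   Context: For a compact Hausdorff space $Z$, $C(Z)$ is the space of continuous real-valued functions with the sup-norm $\|\cdot\|$, and $\mathbb R^{C(Z)}$ is the space of all functions (functionals) $\mu:C(Z)\to\mathbb R$ with the product topology. $F(Z)\subset\mathbb R^{C(Z)}$ carries the subspace topology, and for a continuous map $f:Z\to Y$ the map $Ff:F(Z)\to F(Y)$ is $Ff(\mu)(\varphi)=\mu(\varphi\circ f)$. A functional $\mu:C(Z)\to\mathbb R$ preserves constants if $\mu(c_Z)=c$ for every constant function $c_Z\equiv c$; weakly preserves order if $\mu(a)\le\mu(f)\le\mu(b)$ for any $f\in C(Z)$ and constant functions $a\le f\le b$; is weakly additive if $\mu(f+c)=\mu(f)+\mu(c)$ for all $f\in C(Z)$ and constant functions $c$; is weakly multiplicative if $\mu(c\cdot f)=\mu(c)\cdot\mu(f)$ for all $f\in C(Z)$ and (real) constant functions $c$; is $k$-Lipschitz if $|\mu(f)-\mu(g)|\le k\|f-g\|$ for all $f,g\in C(Z)$. For a closed subset $A\subset X$ with inclusion $i_A^X$, ''$a\in FA\subset FX$'' means $a\in Fi_A^X(FA)$. A compact Hausdorff space $X$ is an absolute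 $F$-valued retract if for any embedding $X\subset Y$ into a compact Hausdorff space $Y$ there is a continuous map $r:Y\to FX$ such that $r(x)\in F(\{x\})\subset FX$ for every $x\in X$. A compact Hausdorff space is openly generated (in the sense of Shchepin) if it is homeomorphic to the limit of an inverse system $\{X_\alpha,p_\alpha^\beta,A\}$ of metrizable compact spaces with open surjective bonding maps, where the directed index set $A$ is $\sigma$-complete (every countable chain in $A$ has a supremum in $A$) and the system is continuous (for every countable chain $B\subset A$ with supremum $\beta$, $X_\beta$ is canonically the limit of $\{X_\alpha\}_{\alpha\in B}$). *)

(* Defs.v *)
From HB Require Import structures.
From mathcomp Require Import all_boot all_order all_algebra.
From mathcomp Require Import all_classical all_reals all_analysis.
Import Order.TTheory GRing.Theory Num.Theory.
Import numFieldNormedType.Exports.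

Set Implicit Arguments.
Unset Strict Implicit.
Unset Printing Implicit Defensive.

Local Open Scope classical_set_scope.
Local Open Scope ring_scope.

(** * Spaces and maps *)

Definition compact_hausdorff (X : topologicalType) : Prop :=
  compact [set: X] /\ hausdorff_space X.

Definition homeomorphism (X Y : topologicalType) (f : X -> Y) : Prop :=
  continuous f /\
  exists g : Y -> X, [/\ continuous g, cancel f g & cancel g f].

Definition homeomorphic (X Y : topologicalType) : Prop :=
  exists f : X -> Y, homeomorphism f.

(* The second conjunct says that the topology of [X] is the one induced by
   [i]; in particular [i] is continuous. *)
Definition embedding (X Y : topologicalType) (i : X -> Y) : Prop :=
  injective i /\ @open X = [set i @^-1` V | V in @open Y].

Definition open_map (X Y : topologicalType) (f : X -> Y) : Prop :=
  forall U : set X, open U -> open (f @` U).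

Definition metrizable (R : realType) (X : topologicalType) : Prop :=
  exists M : metricType R, homeomorphic X M.

(** * Inverse systems and openly generated spaces *)

Record inverse_system (d : Order.disp_t) (A : porderType d) := InverseSystem {
  stage :> A -> topologicalType ;
  bond : forall a b : A, (a <= b)%O -> stage b -> stage a ;
  bond_continuous : forall (a b : A) (ab : (a <= b)%O), continuous (bond ab) ;
  bond_id : forall (a : A) (aa : (a <= a)%O) x, bond aa x = x ;
  bond_comp : forall (a b c : A) (ab : (a <= b)%O) (bc : (b <= c)%O)
      (ac : (a <= c)%O) x, bond ab (bond bc x) = bond ac x }.

Arguments bond {d A} _ {a b} _ _.
Arguments bond_continuous {d A} _ {a b} _.
Arguments bond_id {d A} _ {a} _ _.
Arguments bond_comp {d A} _ {a b c} _ _ _ _.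

Section limits.
Variables (d : Order.disp_t) (A : porderType d) (S : inverse_system A).

(* The limit of the restriction of [S] to [B]; it is used as a type, i.e. as a
   subspace of the product of the [S a] for [a] in [B]. *)
Definition system_limit (B : set A) :
    set (prod_topology (fun a : set_type B => S (set_val a))) :=
  [set x | forall (a b : set_type B) (ab : (set_val a <= set_val b)%O),
             bond S ab (x b) = x a].

Section canonical_map.
Variables (B : set A) (beta : A) (ub : ubound B beta).

Definition canonical_thread (x : S beta) :
    prod_topology (fun a : set_type B => S (set_val a)) :=
  fun a => bond S (ub (set_valP a)) x.

Lemma canonical_thread_limit (x : S beta) : system_limit (canonical_thread x).
Proof. by move=> a b ab; exact: bond_comp. Qed.

Definition canonical_map (x : S beta) : set_type (system_limit (B := B)) :=
  SigSub (mem_set (canonical_thread_limit x)).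

End canonical_map.
End limits.

Definition directed (d : Order.disp_t) (A : porderType d) : Prop :=
  [set: A] !=set0 /\ forall a b : A, exists c : A, (a <= c)%O /\ (b <= c)%O.

(* Chains are nonempty: the empty chain would force a least index [a0], with
   a one-point space [S a0]. *)
Definition countable_chain (d : Order.disp_t) (A : porderType d)
    (B : set A) : Prop :=
  [/\ B !=set0, countable B & total_on B (fun a b => (a <= b)%O)].

Definition sigma_complete (d : Order.disp_t) (A : porderType d) : Prop :=
  forall B : set A, countable_chain B -> supremums B !=set0.

Definition continuous_system (d : Order.disp_t) (A : porderType d)
    (S : inverse_system A) : Prop :=
  forall (B : set A) (beta : A) (sup_beta : supremums B beta),
    countable_chain B ->
    homeomorphism (canonical_map (S := S) (proj1 sup_beta)).

Definition openly_generated (R : realType) (X : topologicalType) : Prop :=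
  compact_hausdorff X /\
  exists (d : Order.disp_t) (A : porderType d) (S : inverse_system A),
    [/\ directed A /\ sigma_complete A,
        continuous_system S,
        forall a : A, compact [set: S a] /\ metrizable R (S a),
        forall (a b : A) (ab : (a <= b)%O),
          open_map (bond S ab) /\ set_surj setT setT (bond S ab)
      & homeomorphic X (set_type (system_limit (S := S) (B := [set: A])))].

(** * Functionals on continuous functions *)

Section functionals.
Variable R : realType.

Definition contfun (Z : topologicalType) : Type := continuousType Z R.

Definition functional (Z : topologicalType) : Type := {ptws contfun Z -> R}.

HB.instance Definition _ Z :=
  Topological.copy (functional Z) {ptws contfun Z -> R}.

Section operations.
Variable Z : topologicalType.

Lemma addc_continuous (f : contfun Z) (c : R) : continuous (fun z => f z + c).
Proof. by move=> z; apply: cvgD; [exact: cts_fun | exact: cvg_cst]. Qed.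

Lemma mulc_continuous (c : R) (f : contfun Z) : continuous (fun z => c * f z).
Proof. by move=> z; apply: cvgM; [exact: cvg_cst | exact: cts_fun]. Qed.

Definition constC (c : R) : contfun Z := cst c.
Definition addcC (f : contfun Z) (c : R) : contfun Z := mkcts (@addc_continuous f c).
Definition mulcC (c : R) (f : contfun Z) : contfun Z := mkcts (@mulc_continuous c f).

Definition supnorm (f : Z -> R) : R := sup [set `|f z| | z in [set: Z]].

Variable mu : functional Z.

Definition preserves_constants : Prop := forall c : R, mu (constC c) = c.

Definition weakly_preserves_order : Prop :=
  forall (f : contfun Z) (a b : R), (forall z, a <= f z <= b) ->
    mu (constC a) <= mu f <= mu (constC b).

Definition weakly_additive : Prop :=
  forall (f : contfun Z) (c : R), mu (addcC f c) = mu f + mu (constC c).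

Definition weakly_multiplicative : Prop :=
  forall (c : R) (f : contfun Z), mu (mulcC c f) = mu (constC c) * mu f.

Definition lipschitz_functional (k : R) : Prop :=
  forall f g : contfun Z, `|mu f - mu g| <= k * supnorm (f \- g).

End operations.

Definition Fmap (Z Y : topologicalType) (f : continuousType Z Y)
  (mu : functional Z) : functional Y := fun phi : contfun Y => mu (phi \o f : contfun Z).

Lemma set_val_continuous (X : topologicalType) (A : set X) :
  continuous (set_val : set_type A -> X).
Proof. exact: initial_continuous. Qed.

Definition inclusion (X : topologicalType) (A : set X) :
  continuousType (set_type A) X := mkcts (@set_val_continuous X A).

Section valued_retracts.
Variable F : forall Z : topologicalType, set (functional Z).

(* [F(A)] viewed inside [F(X)]. *)
Definition Fsub (X : topologicalType) (A : set X) : set (functional X) :=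
  Fmap (inclusion A) @` @F (set_type A).

Definition absolute_valued_retract (X : topologicalType) : Prop :=
  compact_hausdorff X /\
  forall (Y : topologicalType) (i : X -> Y),
    compact_hausdorff Y -> embedding i ->
    exists r : Y -> set_type (@F X),
      continuous r /\ forall x : X, Fsub [set x] (set_val (r (i x))).

End valued_retracts.

Definition F3 (Z : topologicalType) : set (functional Z) :=
  [set mu | [/\ preserves_constants mu, weakly_multiplicative mu,
                weakly_additive mu, weakly_preserves_order mu
              & lipschitz_functional mu 3]].

End functionals.

(* Main.v *)
(**
Let [o] be the non-isolated point of [X]. All other points are isolated, so by
compactness every neighbourhood of [o] is cofinite.

Valued retract: given [X] inside [Y], Urysohn's lemma yields for each [x <> o]
a function [h_x : Y -> [0, 1]] with [h_x x = 1] and [h_x = 0] on the rest of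
[X]. Set [M_y phi = sup_x (phi o + h_x y * max (phi x - phi o) 0)] and
[r y phi = M_y phi - M_y (- phi) - phi o], a sum of three 1-Lipschitz terms.
Continuity in [y] holds because [phi x - phi o] is small off a finite set.

Not openly generated: if [X] were the limit of a sigma-complete system, some
index [b] would lie above countably many indices that separate the points of
an infinite sequence. In the metrizable stage [S b] the image [q] of [o] is a
G_delta, so its fibre in [X] is co-countable and contains an isolated point of
[X]. Openness of the bonding maps makes [q] isolated in [S b]; its fibre is
then cofinite in [X], so [X] has finite image in [S b], a contradiction.
*)
From HB Require Import structures.
Require Import Defs.
From mathcomp Require Import all_boot all_order all_algebra.
From mathcomp Require Import finmap.
From mathcomp Require Import all_classical all_reals all_analysis.
From mathcomp Require Import ring lra.
Import Order.TTheory GRing.Theory Num.Theory.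
Import numFieldNormedType.Exports.

Set Implicit Arguments.
Unset Strict Implicit.
Unset Printing Implicit Defensive.

Local Open Scope classical_set_scope.
Local Open Scope ring_scope.

(** * Neighbourhoods when all points but [o] are isolated *)

Lemma isolated_setT (X : topologicalType) (x : X) :
  isolated [set: X] x <-> nbhs x [set x].
Proof.
split=> [[_ [V xV]]|xx]; first by rewrite setIT => <-.
by split; [rewrite inE | exists [set x]; rewrite ?setIT].
Qed.

(** If the complement of [V] were infinite, removing finite sets from it would generate a proper
    filter. Its cluster point cannot be [o], since [V] misses the filter sets, nor an isolated [p],
    since [p] itself can be removed. *)
Lemma cofinite_nbhs (X : topologicalType) (o : X) :
  compact [set: X] -> (forall x, x <> o -> nbhs x [set x]) ->
  forall V, nbhs o V -> finite_set (~` V).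
Proof.
move=> cX isoX V oV; apply: contrapT => infV.
pose F := filter_from [set A : set X | finite_set A] (fun A => ~` V `\` A).
have FF : ProperFilter F.
  apply: filter_from_proper; last first.
    by move=> A finA; apply: infinite_setN0; exact: infinite_setD.
  apply: filter_from_filter; first by exists set0; exact: finite_set0.
  move=> A B finA finB; exists (A `|` B); first by rewrite /= finite_setU.
  by move=> x [Vx /not_orP[Ax Bx]].
have [|p [_ clp]] := cX F FF; first exact: filterT.
have [po|po] := pselect (p = o).
  have [||x [[Vx _]]] // := clp (~` V `\` set0) V; last by rewrite po.
  by exists set0 => //; exact: finite_set0.
have [|x [[_ xp] /xp]] // := clp (~` V `\` [set p]) [set p] _ (isoX _ po).
by exists [set p] => //; exact: finite_set1.
Qed.

(** * Limits of inverse systems with open surjective bonding maps *)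

Section inverse_limit.
Variables (d : Order.disp_t) (A : porderType d) (S : inverse_system A).

Local Notation limit := (set_type (system_limit (S := S) (B := [set: A]))).

Definition limit_proj (a : A) (x : limit) : S a :=
  set_val x (SigSub (mem_set (I : [set: A] a))).

Lemma limit_projE (a b : A) (ab : (a <= b)%O) x :
  bond S ab (limit_proj b x) = limit_proj a x.
Proof.
have xP : system_limit (set_val x) := set_valP x.
exact: (xP (SigSub (mem_set I)) (SigSub (mem_set I)) ab).
Qed.

Lemma limit_proj_inj x y : (forall a, limit_proj a x = limit_proj a y) -> x = y.
Proof.
move=> xy; apply: val_inj; apply: functional_extensionality_dep => -[a aT].
by have := xy a; rewrite /limit_proj (Prop_irrelevance (mem_set _) aT).
Qed.

Lemma limit_proj_continuous (a : A) : continuous (@limit_proj a).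
Proof.
move=> x; pose P := prod_topology (fun b : set_type [set: A] => S (set_val b)).
apply: (@continuous_comp _ P _ set_val
  (fun f : P => f (SigSub (mem_set (I : [set: A] a))))).
  exact: initial_continuous.
exact: (@proj_continuous _ (fun b : set_type [set: A] => S (set_val b))).
Qed.

Hypothesis dirA : directed A.

(** [sigma_complete] concerns chains, so directedness first yields an increasing sequence [v] with
    [u n <= v n]; the range of [v] then has a supremum. *)
Lemma countable_bounded (u : nat -> A) :
  sigma_complete A -> exists b, forall n, (u n <= b)%O.
Proof.
move=> sA; have [ub ubP] : {ub : A -> A -> A | forall a b, a <= ub a b /\ b <= ub a b}%O.
  have h a b := cid (dirA.2 a b).
  by exists (fun a b => sval (h a b)) => a b; exact: svalP (h a b).
pose v := fix v n := if n is m.+1 then ub (v m) (u n) else u 0%N.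
have v_homo : {homo v : m n / (m <= n)%N >-> (m <= n)%O}.
  by apply: homo_leq => [//|y x z|n]; [exact: le_trans|exact: (ubP _ _).1].
have [|b [bP _]] := sA (range v).
  split; first by exists (v 0%N), 0%N.
    exact: (card_le_trans (card_image_le _ _)).
  move=> _ _ [m _ <-] [n _ <-]; have [mn|/ltnW nm] := leqP m n.
    by left; exact: v_homo.
  by right; exact: v_homo.
exists b => n; apply: (@le_trans _ _ (v n)); last by apply: bP; exists n.
by case: n => [//|n]; exact: (ubP _ _).2.
Qed.

Hypothesis cptS : forall a, compact [set: S a].
Hypothesis hausS : forall a, hausdorff_space (S a).
Hypothesis surjS : forall (a b : A) (ab : (a <= b)%O),
  set_surj setT setT (bond S ab).

(** The sets [K c] with [a <= c] are nonempty because [s] lifts to [S c], and they shrink as [c]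
    grows, so they have a cluster point in the compact product. Hausdorff stages turn clustering
    into exact coherence and the exact value [s]. *)
Lemma limit_proj_surj (a : A) (s : S a) : exists x, limit_proj a x = s.
Proof.
pose P := prod_topology (fun b : set_type [set: A] => S (set_val b)).
(* The threads over [s] that are coherent below [c]. *)
pose K c : set P := [set x | exists t : S c,
  (forall ac : (a <= c)%O, bond S ac t = s) /\
  forall b (bc : (set_val b <= c)%O), x b = bond S bc t].
have mono c c' (cc' : (c <= c')%O) : (a <= c)%O -> K c' `<=` K c.
  move=> ac x [t [ts xt]]; exists (bond S cc' t); split.
    by move=> ac'; rewrite (bond_comp _ ac' cc' (le_trans ac' cc')).
  by move=> b bc; rewrite (bond_comp _ bc cc' (le_trans bc cc')).
have liftS c : (a <= c)%O -> exists t : S c, forall ac : (a <= c)%O, bond S ac t = s.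
  move=> ac; have [t _ ts] := surjS ac (I : [set: S a] s).
  by exists t => ac'; rewrite (Prop_irrelevance ac' ac).
have inhS b : inhabited (S b).
  have [c [ac bc]] := dirA.2 a b; have [t _] := liftS _ ac.
  exact: inhabits (bond S bc t).
pose pt b : S b := inhabited_witness (inhS b).
have K0 c : (a <= c)%O -> K c !=set0.
  move=> ac; have [t ts] := liftS _ ac.
  (* Coordinates not below [c] are unconstrained and take the default [pt]. *)
  exists (fun b => if pselect (set_val b <= c)%O is left bc then bond S bc t
                   else pt _).
  exists t; split => // b bc; case: pselect => // bc'.
  by rewrite (Prop_irrelevance bc' bc).
pose F := filter_from [set c | (a <= c)%O] K.
have FF : ProperFilter F.
  apply: filter_from_proper => //; apply: filter_from_filter; first by exists a => /=.
  move=> b c /= ab ac; have [e [be ce]] := dirA.2 b c.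
  exists e; first exact: le_trans be.
  by move=> x Kx; split; [exact: mono be _ x Kx|exact: mono ce _ x Kx].
have cptP : compact [set: P].
  have := tychonoff (fun b : set_type [set: A] => @cptS (set_val b)).
  by congr compact; apply/seteqP; split.
have [|x [_ clx]] := cptP F FF; first exact: filterT.
have near_proj b U : nbhs (x b) U -> nbhs x [set y : P | U (y b)].
  exact: (@proj_continuous _ (fun b : set_type [set: A] => S (set_val b)) b x).
have xlim : system_limit x.
  move=> b c bc; apply: hausS => U V xU xV.
  have [e [ae ce]] := dirA.2 a (set_val c).
  have [||y [[t [_ yt]] [Uy Vy]]] := clx (K e)
      ([set y : P | U (bond S bc (y c))] `&` [set y | V (y b)]).
  - by exists e.
  - apply: filterI; last exact: near_proj b V xV.
    by apply: (near_proj c (bond S bc @^-1` U)); exact: bond_continuous.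
  exists (y b); split => //.
  rewrite (yt _ (le_trans bc ce)) -(bond_comp _ bc ce) -yt //.
exists (SigSub (mem_set xlim)); apply: hausS => U V xU sV.
have [||y [[t [ts yt]] Uy]] := clx (K a)
    [set y : P | U (y (SigSub (mem_set (I : [set: A] a))))].
- by exists a => /=.
- exact: (near_proj (SigSub (mem_set (I : [set: A] a))) U xU).
exists s; split; last exact: nbhs_singleton sV.
by rewrite -(ts (lexx a)) -[bond _ _ _](yt (SigSub (mem_set (I : [set: A] a)))).
Qed.

Lemma limit_nbhs (x : limit) N : nbhs x N ->
  exists a (U : set (S a)), nbhs (limit_proj a x) U /\ limit_proj a @^-1` U `<=` N.
Proof.
case=> _ [[W oW <-] Wx] WN.
pose P := prod_topology (fun b : set_type [set: A] => S (set_val b)).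
(* By directedness the sets controlled by a single coordinate form a filter. *)
pose G : set_system P := [set M | exists a (U : set (S a)),
  nbhs (limit_proj a x) U /\ forall y, U (limit_proj a y) -> M (set_val y)].
have GF : Filter G.
  split.
  - by have [[a _] _] := dirA; exists a, setT; split => //; exact: filterT.
  - move=> M N' [a [U [xU UM]]] [b [V [xV VN]]].
    have [c [ac bc]] := dirA.2 a b.
    exists c, (bond S ac @^-1` U `&` bond S bc @^-1` V); split.
      by apply: filterI; apply: bond_continuous; rewrite limit_projE.
    by move=> y [/=]; rewrite !limit_projE; split; [exact: UM|exact: VN].
  - move=> M M' MM' [a [U [xU UM]]]; exists a, U; split => // y /UM.
    exact: MM'.
(* The product topology is a supremum of topologies induced by coordinates, so convergence is
   checked one coordinate at a time. *)
have : G --> (set_val x : P).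
  apply/cvg_sup => -[a aT] M [_ [[U oU <-] Ux] UM].
  have aE : aT = mem_set (I : [set: A] a) by exact: Prop_irrelevance.
  exists a, U; split.
    by apply: open_nbhs_nbhs; split => //; rewrite /limit_proj -aE.
  by move=> y Uy; apply: UM; rewrite /= aE.
move=> /(_ W) [|a [U [xU UW]]]; first exact: open_nbhs_nbhs.
by exists a, U; split => // y /UW /WN.
Qed.

(** Some stage [c] already isolates [x] by a cylinder. At a stage [b] above [a] and [c],
    surjectivity of the projection makes the image of [x] isolated, and the open bonding map carries
    this down to [a]. *)
Lemma isolated_limit_proj (x : limit) (a : A) :
  (forall (a b : A) (ab : (a <= b)%O), open_map (bond S ab)) ->
  nbhs x [set x] -> nbhs (limit_proj a x) [set limit_proj a x].
Proof.
move=> openS /limit_nbhs[c [U [xU Ux]]].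
have [b [ab cb]] := dirA.2 a c.
have isob : nbhs (limit_proj b x) [set limit_proj b x].
  apply: (@filterS _ _ _ (bond S cb @^-1` U)); last first.
    by apply: bond_continuous; rewrite limit_projE.
  move=> t Ut; have [y yt] := limit_proj_surj t.
  by have <- : y = x by apply: Ux; rewrite /= -(limit_projE cb) yt.
have : open [set limit_proj b x] by rewrite openE => _ ->.
move=> /(openS _ _ ab); rewrite image_set1 limit_projE => o1.
by apply: open_nbhs_nbhs; split.
Qed.

End inverse_limit.

(** * Failure of open generation *)

Section not_openly_generated.
Variables (R : realType) (X : topologicalType) (o : X).
Hypothesis isoX : forall x, x <> o -> nbhs x [set x].
Hypothesis uncX : ~ countable [set: X].

(** Preimages of the balls of radius [1/(n+1)] about the image of [o] are cofinite. If [o] were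
    alone in its fibre, every other point would leave one of them, and [X] would be a countable
    union of finite sets. *)
Lemma infinite_fiber_metrizable (M : topologicalType) (p : X -> M) :
  compact [set: X] -> metrizable R M -> continuous p ->
  exists2 x, x <> o & p x = p o.
Proof.
move=> cX [N [k [ck [g [_ kg _]]]]] cp; apply: contrapT => nex; apply: uncX.
pose V n := (k \o p) @^-1` ball (k (p o)) n.+1%:R^-1.
suff -> : [set: X] = \bigcup_n (o |` ~` V n).
  apply: bigcup_countable => // n _; apply/finite_set_countable.
  rewrite finite_setU; split; first exact: finite_set1.
  apply: (cofinite_nbhs cX isoX); apply: (continuous_comp (cp o) (ck (p o))).
  by apply: nbhsx_ballx; rewrite invr_gt0.
apply/seteqP; split=> // x _; have [->|xo] := pselect (x = o).
  by exists 0%N => //; left.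
have : 0 < mdist (k (p o)) (k (p x)).
  rewrite mdist_gt0; apply/eqP => /(can_inj kg) pox.
  by apply: nex; exists x.
move=> /ltr_add_invr[n]; rewrite add0r => nd.
by exists n => //; right; rewrite /V/= ballEmdist/= => /(lt_trans nd); rewrite ltxx.
Qed.

Lemma not_openly_generated : ~ openly_generated R X.
Proof.
move=> [[cX hX] [d [A [S [[dirA sA] _ cmS obS [f [cf [g [cg fg gf]]]]]]]]].
have cptS a := (cmS a).1.
have hausS a : hausdorff_space (S a).
  have [M [k [ck [h [_ kh _]]]]] := (cmS a).2.
  move=> x y xy; apply: (can_inj kh); apply: metric_hausdorff => U V kU kV.
  have [||z [Uz Vz]] := xy (k @^-1` U) (k @^-1` V); [exact: ck|exact: ck|].
  by exists (k z).
have surjS a b (ab : (a <= b)%O) := (obS a b ab).2.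
have openS a b (ab : (a <= b)%O) := (obS a b ab).1.
have [e einj] : exists e : nat -> X, injective e.
  pose Xp : pointedType := HB.pack (Choice.sort X) (isPointed.Build X o).
  have /(@infiniteP Xp)/pcard_injP[e einj] : infinite_set [set: X].
    by move=> /finite_set_countable.
  by exists e => m n; apply: einj; rewrite inE.
(* One stage separates the whole sequence: for each [m] the separating indices are bounded over [n],
   then these bounds are bounded over [m]. *)
have [b bP] : exists b, forall m n, m != n ->
    limit_proj b (f (e m)) <> limit_proj b (f (e n)).
  have sep m n : exists a, m != n -> limit_proj a (f (e m)) <> limit_proj a (f (e n)).
    have [->|mn] := eqVneq m n; first by have [[a _] _] := dirA; exists a.
    apply: contrapT => nsep; move/eqP: mn; apply.
    apply: einj; rewrite -[LHS]fg -[RHS]fg; congr g.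
    apply: limit_proj_inj => a; apply: contrapT => mna.
    by apply: nsep; exists a.
  have bnd m : exists a, forall n, m != n ->
      limit_proj a (f (e m)) <> limit_proj a (f (e n)).
    have [u uP] := choice (sep m).
    have [a ua] := countable_bounded dirA u sA; exists a => n mn mna.
    by apply: (uP n mn); rewrite -!(limit_projE (ua n)) mna.
  have [u uP] := choice bnd; have [a ua] := countable_bounded dirA u sA.
  exists a => m n mn mna.
  by apply: (uP m n mn); rewrite -!(limit_projE (ua m)) mna.
pose p := limit_proj b \o f.
have cp : continuous p.
  by move=> x; apply: continuous_comp; [exact: cf|exact: limit_proj_continuous].
have [x xo pxo] := infinite_fiber_metrizable cX (cmS b).2 cp.
(* The isolated point [x] has an isolated image, which is also the image of [o]; hence the fibre of
   [o] is a neighbourhood of [o] and is cofinite. *)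
have : nbhs (f x) [set f x].
  have gx : nbhs (f x) (g @^-1` [set x]).
    by apply: cg; rewrite fg; exact: isoX.
  by apply: filterS gx => y /= <-; rewrite gf.
move=> /(isolated_limit_proj dirA cptS hausS surjS b openS).
rewrite [limit_proj b (f x)]pxo => /cp/(cofinite_nbhs cX isoX) fin.
(* The images of the terms are distinct, so at most one term lies in the fibre of [o]; if none does,
   [0] is an arbitrary choice. *)
have [n0 en0] : exists n0, forall n, n != n0 -> p (e n) <> p o.
  have [[n0 pn0]|nex] := pselect (exists n, p (e n) = p o); last first.
    by exists 0%N => n _ pn; apply: nex; exists n.
  by exists n0 => n nn0 pn; apply: (bP _ _ nn0); exact: etrans pn (esym pn0).
apply: infinite_nat.
rewrite -(setvU [set n0]) finite_setU; split=> //.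
have := @finite_preimage _ _ _ e (in2W einj) fin.
by apply: sub_finite_set => n /eqP /en0.
Qed.

End not_openly_generated.

(** * The functional attached to a weight on [X] *)

Section tent_functional.
Variables (R : realType) (X : Type) (o : X).
Implicit Types (w v f g : X -> R).

Definition bounded_fun f := exists C : R, forall x, `|f x| <= C.

Definition tent w f (x : X) : R := f o + w x * Num.max (f x - f o) 0.

Definition tent_sup w f : R := sup (range (tent w f)).

(** Subtracting the value at [- f] makes the functional odd, which gives homogeneity for negative
    scalars; subtracting [f o] restores constants, as [c - (- c) - c = c]. *)
Definition tent_functional w f : R :=
  tent_sup w f - tent_sup w (fun x => - f x) - f o.

Lemma bounded_funN f : bounded_fun f -> bounded_fun (fun x => - f x).
Proof. by move=> [C fC]; exists C => x; rewrite normrN. Qed.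

Lemma bounded_funZ (c : R) f : bounded_fun f -> bounded_fun (fun x => c * f x).
Proof.
by move=> [C fC]; exists (`|c| * C) => x; rewrite normrM ler_wpM2l.
Qed.

Lemma bounded_fun_cst (c : R) : bounded_fun (fun=> c).
Proof. by exists `|c|. Qed.

Lemma ge_tent_sup w f (c : R) : (forall x, tent w f x <= c) -> tent_sup w f <= c.
Proof.
move=> fc; apply: ge_sup; first by exists (tent w f o), o.
by move=> _ [x _ <-].
Qed.

Section weight.
Variable w : X -> R.
Hypothesis w01 : forall x, 0 <= w x <= 1.

Lemma le_tent_sup f x : bounded_fun f -> tent w f x <= tent_sup w f.
Proof.
move=> [C fC]; apply: ub_le_sup; last by exists x.
exists C => _ [y _ <-]; rewrite /tent; have /andP[w0 w1] := w01 y.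
have := fC y; have := fC o; rewrite !ler_norml => /andP[_ ho] /andP[_ hy].
by case: (leP (f y - f o) 0) => h; nra.
Qed.

(* [tent w f x] is the larger of [f o] and [(1 - w x) * f o + w x * f x]. *)
Lemma tent_sup_leD f g (c : R) : bounded_fun g -> (forall x, f x <= g x + c) ->
  tent_sup w f <= tent_sup w g + c.
Proof.
move=> bg fg; apply: ge_tent_sup => x.
apply: le_trans (_ : tent w g x + c <= _); last by rewrite lerD2r le_tent_sup.
have /andP[w0 w1] := w01 x; have := fg x; have := fg o; rewrite /tent.
by case: (leP (f x - f o) 0) => h; case: (leP (g x - g o) 0) => h'; nra.
Qed.

Lemma tent_sup_cst (c : R) : tent_sup w (fun=> c) = c.
Proof.
have tc : tent w (fun=> c) = fun=> c.
  by apply/funext => x; rewrite /tent subrr maxxx mulr0 addr0.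
rewrite /tent_sup tc (_ : range _ = [set c]) ?sup1//.
by apply/seteqP; split=> [_ [x _ <-]//|_ ->]; exists o.
Qed.

Lemma tent_supD f (c : R) : bounded_fun f ->
  tent_sup w (fun x => f x + c) = tent_sup w f + c.
Proof.
move=> bf; apply/eqP; rewrite eq_le tent_sup_leD//= -lerBrDr.
apply: tent_sup_leD => [|x]; last by rewrite addrK.
have [C fC] := bf; exists (C + `|c|) => x.
by rewrite (le_trans (ler_normD _ _))// lerD2r.
Qed.

(** For [c > 0] the inequality [le_supZ] is used twice, with [c] and with its inverse. *)
Lemma tent_supZ (c : R) f : bounded_fun f -> 0 <= c ->
  tent_sup w (fun x => c * f x) = c * tent_sup w f.
Proof.
have le_supZ (a : R) g : bounded_fun g -> 0 <= a ->
    tent_sup w (fun x => a * g x) <= a * tent_sup w g.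
  move=> bg a0; apply: ge_tent_sup => x.
  apply: le_trans (ler_wpM2l a0 (le_tent_sup x bg)).
  by rewrite /tent -mulrBr -[X in Num.max _ X](mulr0 a) -maxr_pMr// mulrDr mulrCA.
move=> bf; rewrite le_eqVlt => /predU1P[<-|c0].
  rewrite (_ : (fun x => _) = fun=> 0) ?tent_sup_cst ?mul0r//.
  by apply/funext => x; rewrite mul0r.
apply/eqP; rewrite eq_le le_supZ//=; last exact: ltW.
rewrite -ler_pdivlMl//.
have {1}-> : f = (fun x => c^-1 * (c * f x)).
  by apply/funext => x; rewrite mulKf// gt_eqF.
by apply: le_supZ; [exact: bounded_funZ|rewrite invr_ge0 ltW].
Qed.

Lemma tent_functional_cst (c : R) : tent_functional w (fun=> c) = c.
Proof. by rewrite /tent_functional !tent_sup_cst opprK addrK. Qed.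

Lemma tent_functionalN f : tent_functional w (fun x => - f x) = - tent_functional w f.
Proof.
rewrite /tent_functional (_ : (fun x => - - f x) = f); first by ring.
by apply/funext => x; rewrite opprK.
Qed.

Lemma tent_functionalZ (c : R) f : bounded_fun f ->
  tent_functional w (fun x => c * f x) = c * tent_functional w f.
Proof.
have pos (a : R) g : 0 <= a -> bounded_fun g ->
    tent_functional w (fun x => a * g x) = a * tent_functional w g.
  move=> a0 bg; rewrite /tent_functional.
  rewrite (_ : (fun x => - (a * g x)) = fun x => a * - g x).
    by rewrite !tent_supZ//; [ring|exact: bounded_funN].
  by apply/funext => x; rewrite mulrN.
move=> bf; have [c0|/ltW c0] := leP 0 c; first exact: pos.
rewrite -[c in RHS]opprK mulNr -pos ?oppr_ge0// -tent_functionalN.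
by congr tent_functional; apply/funext => x; rewrite mulNr opprK.
Qed.

Lemma tent_functionalD f (c : R) : bounded_fun f ->
  tent_functional w (fun x => f x + c) = tent_functional w f + c.
Proof.
move=> bf; rewrite /tent_functional.
rewrite (_ : (fun x => - (f x + c)) = fun x => - f x + - c).
  by rewrite !tent_supD//; [ring|exact: bounded_funN].
by apply/funext => x; rewrite opprD.
Qed.

(** The tent of [- f] at [o] shows that the two subtracted terms contribute at most 0, which leaves
    [tent_sup w f <= b]. *)
Lemma tent_functional_le f (b : R) : bounded_fun f -> (forall x, f x <= b) ->
  tent_functional w f <= b.
Proof.
move=> bf fb.
have fo : - f o <= tent_sup w (fun x => - f x).
  have := le_tent_sup o (bounded_funN bf).
  by rewrite {1}/tent subrr maxxx mulr0 addr0.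
have : tent_sup w f <= b.
  rewrite -[leRHS]add0r -{1}(tent_sup_cst 0).
  by apply: tent_sup_leD => [|x]; [exact: bounded_fun_cst|rewrite add0r].
by rewrite /tent_functional; lra.
Qed.

Lemma tent_functional_lipschitz f g (e : R) : bounded_fun f -> bounded_fun g ->
  (forall x, `|f x - g x| <= e) ->
  `|tent_functional w f - tent_functional w g| <= 3 * e.
Proof.
move=> bf bg fg; have := fg o; rewrite !ler_norml => /andP[fgo gfo].
have fle x : f x <= g x + e by have := fg x; rewrite ler_norml; lra.
have gle x : g x <= f x + e by have := fg x; rewrite ler_norml; lra.
have := tent_sup_leD bg fle; have := tent_sup_leD bf gle.
have := @tent_sup_leD (fun x => - f x) (fun x => - g x) e (bounded_funN bg)
  (fun x => ltac:(have := gle x; lra)).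
have := @tent_sup_leD (fun x => - g x) (fun x => - f x) e (bounded_funN bf)
  (fun x => ltac:(have := fle x; lra)).
by rewrite /tent_functional => *; apply/andP; split; lra.
Qed.

Lemma tent_sup_le_weight v f (e : R) : bounded_fun f ->
  (forall x, `|v x - w x| * Num.max (f x - f o) 0 <= e) ->
  tent_sup v f <= tent_sup w f + e.
Proof.
move=> bf vw; apply: ge_tent_sup => x.
apply: le_trans (_ : tent w f x + e <= _); last by rewrite lerD2r le_tent_sup.
rewrite /tent -addrA lerD2l -lerBlDl -mulrBl (le_trans _ (vw x))//.
by rewrite ler_wpM2r ?le_max ?lexx ?orbT// ler_norm.
Qed.

Lemma tent_sup_point f d : bounded_fun f -> (d <> o -> w d = 1) ->
  (forall x, x <> d -> x <> o -> w x = 0) ->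
  tent_sup w f = f o + Num.max (f d - f o) 0.
Proof.
move=> bf wd w0; apply/eqP; rewrite eq_le; apply/andP; split.
  apply: ge_tent_sup => x; rewrite lerD2l.
  have m0 : 0 <= Num.max (f d - f o) 0 by rewrite le_max lexx orbT.
  have [->|xo] := pselect (x = o); first by rewrite subrr maxxx mulr0.
  have [->|xd] := pselect (x = d); last by rewrite w0// mul0r.
  by rewrite ler_piMl//; have /andP[] := w01 d.
apply: le_trans (le_tent_sup d bf); rewrite lerD2l.
have [->|dO] := pselect (d = o); first by rewrite subrr maxxx mulr0.
by rewrite wd// mul1r.
Qed.

(** For a weight that off [o] is the indicator of [d], the positive parts of [f d - f o] and
    [f o - f d] recombine to evaluation at [d]. The case [d = o] fits, since the tent at [o] equals
    [f o] for every weight. *)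
Lemma tent_functional_point f d : bounded_fun f -> (d <> o -> w d = 1) ->
  (forall x, x <> d -> x <> o -> w x = 0) -> tent_functional w f = f d.
Proof.
move=> bf wd w0; rewrite /tent_functional.
rewrite !(@tent_sup_point _ d)//; last exact: bounded_funN.
by case: (leP (f d - f o) 0); case: (leP (- f d - - f o) 0); lra.
Qed.

End weight.
End tent_functional.

(** * Continuous dependence on the weights and membership in [F3] *)

Lemma continuous_bounded (R : realType) (X : topologicalType) (f : X -> R) :
  compact [set: X] -> continuous f -> bounded_fun f.
Proof.
move=> cX cf.
have /compact_bounded[M [_ fM]] : compact (f @` [set: X]).
  by apply: continuous_compact => //; exact: continuous_subspaceT.
by exists (M + 1) => x; apply: (fM (M + 1)) => //; rewrite ltrDl.
Qed.

Lemma le_supnorm (R : realType) (X : topologicalType) (f : X -> R) x :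
  bounded_fun f -> `|f x| <= supnorm f.
Proof.
by move=> [C fC]; apply: ub_le_sup; [exists C => _ [y _ <-]|exists x].
Qed.

Section continuity.
Variables (R : realType) (X : choiceType) (o : X) (Y : topologicalType).
Variable h : X -> Y -> R.
Hypothesis h01 : forall x y, 0 <= h x y <= 1.
Hypothesis h_cont : forall x, continuous (h x).

Lemma tent_sup_continuous (f : X -> R) : bounded_fun f ->
  (forall e : R, 0 < e -> finite_set [set x | ~ `|f x - f o| <= e]) ->
  continuous (fun y => tent_sup o (h^~ y) f).
Proof.
move=> bf finf y; apply/cvgrPdist_le => e e0; have [C fC] := bf.
(* The positive part of [f x - f o] is at most [2 * C]; the added 1 keeps the divisor positive. *)
have C0 : 0 < 2 * C + 1 by have := fC o; have := normr_ge0 (f o); lra.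
have /finite_fsetP[E EP] := finf e e0.
have nearE : nbhs y (\bigcap_(x in [set` E]%classic)
    [set z | `|h x y - h x z| <= e / (2 * C + 1)]).
  apply: filter_bigI => x _; move: (@h_cont x y) => /cvgrPdist_le; apply.
  by rewrite divr_gt0.
apply: filterS nearE => z hz.
(* Off the finite set [E] the positive part is at most [e] and the weights differ by at most 1; on
   [E] the choice of [z] makes the weights close. *)
have key x : `|h x y - h x z| * Num.max (f x - f o) 0 <= e.
  have [fe|nfe] := pselect (`|f x - f o| <= e).
    have hyz : `|h x y - h x z| <= 1.
      by have := h01 x y; have := h01 x z; rewrite ler_norml; lra.
    rewrite -[leRHS]mul1r ler_pM ?le_max ?lexx ?orbT//.
    by rewrite ge_max (ltW e0) andbT (le_trans (ler_norm _)).
  have Ex : [set` E]%classic x by rewrite -EP.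
  rewrite -[leRHS](divfK (lt0r_neq0 C0)) ler_pM ?le_max ?lexx ?orbT//.
    exact: (hz x Ex).
  by have := fC x; have := fC o; rewrite !ler_norml ge_max; lra.
rewrite ler_distl; apply/andP; split.
  rewrite lerBlDr; apply: tent_sup_le_weight => // x.
  by rewrite distrC.
exact: tent_sup_le_weight.
Qed.

Lemma tent_functional_continuous (f : X -> R) : bounded_fun f ->
  (forall e : R, 0 < e -> finite_set [set x | ~ `|f x - f o| <= e]) ->
  continuous (fun y => tent_functional o (h^~ y) f).
Proof.
move=> bf finf y; apply: cvgB; last exact: cvg_cst.
apply: cvgB; apply: tent_sup_continuous => //; first exact: bounded_funN.
move=> e e0; apply: sub_finite_set (finf e e0) => x /=.
by rewrite -opprD normrN.
Qed.

End continuity.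

Lemma F3_tent_functional (R : realType) (X : topologicalType) (o : X)
    (w : X -> R) : compact [set: X] -> (forall x, 0 <= w x <= 1) ->
  F3 (fun phi : contfun R X => tent_functional o w phi).
Proof.
move=> cX w01.
have bC (f : contfun R X) : bounded_fun f.
  by apply: continuous_bounded => //; exact: cts_fun.
have cstE c : tent_functional o w (constC X c) = c by exact: tent_functional_cst.
split.
- exact: cstE.
- by move=> c f; rewrite cstE; exact: tent_functionalZ.
- by move=> f c; rewrite cstE; exact: tent_functionalD.
- move=> f a b fab; rewrite !cstE; apply/andP; split.
    (* Oddness turns the lower bound into the upper bound for [- f]. *)
    rewrite -lerN2 -tent_functionalN; apply: tent_functional_le => //.
      exact: bounded_funN.
    by move=> x; rewrite lerN2; have /andP[] := fab x.
  by apply: tent_functional_le => // x; have /andP[] := fab x.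
- move=> f g; apply: tent_functional_lipschitz => // x.
  apply: (@le_supnorm _ _ (f \- g)); apply: continuous_bounded => // z.
  by apply: cvgB; exact: cts_fun.
Qed.

(** * Urysohn weights and the valued retraction *)

(** Since [x] is isolated, the rest of [X] is compact, so its image and the point [i x] are disjoint
    closed sets in the normal space [Y]. *)
Lemma point_separation (R : realType) (X Y : topologicalType) (i : X -> Y) (x : X) :
  compact [set: X] -> compact_hausdorff Y -> embedding i -> nbhs x [set x] ->
  exists h : Y -> R, [/\ continuous h, forall y, 0 <= h y <= 1,
    forall z, z <> x -> h (i z) = 0 & h (i x) = 1].
Proof.
move=> cX [cY hY] [inji openi] isox.
have ci : continuous i.
  by apply/continuousP => V oV; rewrite openi; exists V.
have clA : closed (i @` ~` [set x]).
  apply: compact_closed => //; apply: continuous_compact.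
    exact: continuous_subspaceT.
  apply: (subclosed_compact _ cX) => //; apply: open_closedC.
  by rewrite openE => _ ->.
have clB : closed [set i x] by apply: compact_closed => //; exact: compact_set1.
have /(@normal_separatorP R) sepY := compact_normal hY cY.
have AB0 : (i @` ~` [set x]) `&` [set i x] = set0.
  by rewrite -subset0 => _ [[z zx <-] /inji].
have /(@uniform_separatorP _ R)[h [ch h01 hA hB]] := sepY _ _ clA clB AB0.
exists h; split => //.
- by move=> y; have := h01 (h y); rewrite /= in_itv; apply; exists y.
- by move=> z zx; apply: hA; exists (i z) => //; exists z.
- by apply: hB; exists (i x).
Qed.

Lemma F3_absolute_valued_retract (R : realType) (X : topologicalType) (o : X) :
  compact_hausdorff X -> (forall x, x <> o -> nbhs x [set x]) ->
  absolute_valued_retract (@F3 R) X.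
Proof.
move=> cHX isoX; split => // Y i cHY embi; have [cX hX] := cHX.
have /choice[h hP] x : exists h : Y -> R, [/\ continuous h,
    forall y, 0 <= h y <= 1, forall z, z <> x -> x <> o -> h (i z) = 0
    & x <> o -> h (i x) = 1].
  have [->|xo] := pselect (x = o).
    (* The zero function fills the index [o], where the tent ignores the weight. *)
    exists (fun=> 0); split => //; first exact: cst_continuous.
    by move=> y; rewrite lexx ler01.
  have [h [? ? h0 h1]] := @point_separation R _ _ i x cX cHY embi (isoX _ xo).
  by exists h; split => // z zx _; exact: h0.
have h01 x y : 0 <= h x y <= 1 by have [_] := hP x.
pose mu y : functional R X :=
  fun phi : contfun R X => tent_functional o (h^~ y) phi.
have muF y : F3 (mu y) by apply: F3_tent_functional => // x; exact: h01.
have bC (f : contfun R X) : bounded_fun f.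
  by apply: continuous_bounded => //; exact: cts_fun.
exists (fun y => SigSub (mem_set (muF y))); split.
  apply: continuous_comp_initial => y.
  apply/cvg_sup => phi U [V [[W oW <-] /= Wy]] /filterS; apply.
  (* Continuity of [phi] at [o] gives a neighbourhood where [phi] is [e]-close to [phi o], and it is
     cofinite. *)
  have finphi e : 0 < e -> finite_set [set x | ~ `|phi x - phi o| <= e].
    move=> e0; apply: (cofinite_nbhs cX isoX).
    have /cvgrPdist_le/(_ e e0) := @cts_fun _ _ phi o.
    by apply: filterS => z; rewrite distrC.
  apply: (@tent_functional_continuous _ _ o _ _ h01 _ phi _ _ y W).
  - by move=> x; have [] := hP x.
  - exact: bC.
  - exact: finphi.
  - exact: open_nbhs_nbhs.
(* The preimage in [F({x})] is evaluation at the only point; it is 1-Lipschitz, hence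
   3-Lipschitz. *)
move=> x; exists (fun phi : contfun R (set_type [set x]) =>
  phi (SigSub (mem_set (erefl x)))).
  split => // f g; set x0 := SigSub _.
  have le_fg : `|f x0 - g x0| <= supnorm (f \- g).
    apply: (@le_supnorm R (set_type [set x]) (f \- g) x0).
    exists `|f x0 - g x0| => z; suff -> : z = x0 by [].
    by apply: val_inj; exact: (set_valP z).
  by apply: (le_trans le_fg); rewrite ler_peMl ?(le_trans _ le_fg)// ler1n.
apply/funext => phi; change (phi x = tent_functional o (h^~ (i x)) phi).
rewrite (@tent_functional_point _ _ _ _ _ _ x)//.
- by move=> xo; have [_ _ _ ->] := hP x.
- by move=> z zx zo; have [_ _ hz _] := hP z; apply: hz => // xz; exact: zx.
Qed.

(** * One-point compactification of a discrete space *)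

Section one_point_compactification_discrete.
Variable T : choiceType.
Local Notation K := (one_point_compactification (discrete_topology T)).

Lemma isolated_some (x : T) : nbhs (Some x : K) [set Some x : K].
Proof.
rewrite -(image_set1 Some); apply: one_point_compactification_some_nbhs.
exact: discrete_set1.
Qed.

(** Otherwise the discrete space [T] itself would be compact, hence finite by [cofinite_nbhs] with
    any point [t] in the role of [o]. *)
Lemma not_isolated_none : infinite_set [set: T] ->
  ~ nbhs (None : K) [set (None : K)].
Proof.
move=> infT [U [cU _] UN]; apply: infT.
have [->|/set0P[t _]] := eqVneq [set: T] set0; first exact: finite_set0.
have UT : U = setT.
  apply/seteqP; split=> // x _; apply: contrapT => nUx.
  by have : [set (None : K)] (Some x) by apply: UN; left; exists x.
rewrite UT in cU.
rewrite -(setvU [set t]) finite_setU; split; last exact: finite_set1.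
apply: (@cofinite_nbhs (discrete_topology T) t cU); last exact: discrete_set1.
by move=> x _; exact: discrete_set1.
Qed.

Lemma one_point_compactification_discrete_hausdorff : hausdorff_space K.
Proof.
have nbhsN (x : T) : nbhs (None : K) (~` [set Some x : K]).
  exists [set x]; first by split; [exact: compact_set1|exact: discrete_closed].
  by move=> _ [[y yx <-] [/yx]|->].
move=> [x|] [y|] // clxy.
- by have [z [-> ->]] := clxy _ _ (@isolated_some _) (@isolated_some _).
- by have [z [-> /(_ erefl)]] := clxy _ _ (@isolated_some _) (nbhsN x).
- by have [z [/[swap] -> /(_ erefl)]] := clxy _ _ (nbhsN y) (@isolated_some _).
Qed.

End one_point_compactification_discrete.

(** * An uncountable discrete set and the conclusion *)

Lemma uncountable_set_nat : ~ countable [set: set nat].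
Proof.
move=> /pcard_surjP[g gP].
(* Cantor's diagonal set. *)
have [n _ gn] := gP [set n | ~ g n n] I.
have : g n n <-> ~ g n n by rewrite {1}gn.
tauto.
Qed.

Theorem corollary4p8 (R : realType) :
  (forall X : topologicalType,
     compact_hausdorff X ->
     ~ countable [set: X] ->
     (exists! x : X, ~ isolated [set: X] x) ->
     ~ openly_generated R X /\ absolute_valued_retract (@F3 R) X)
  /\ ~ (forall X : topologicalType,
          absolute_valued_retract (@F3 R) X -> openly_generated R X).
Proof.
have key (X : topologicalType) : compact_hausdorff X -> ~ countable [set: X] ->
    (exists! x : X, ~ isolated [set: X] x) ->
    ~ openly_generated R X /\ absolute_valued_retract (@F3 R) X.
  move=> cX uncX [p [_ pU]].
  have isoX x : x <> p -> nbhs x [set x].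
    move=> xo; apply/isolated_setT; apply: contrapT => nx.
    by apply: xo; rewrite (pU x nx).
  split; first exact: not_openly_generated isoX uncX.
  exact: F3_absolute_valued_retract cX isoX.
split=> // retract_open.
(* The second claim needs an actual space satisfying the hypotheses of the first; its only
   non-isolated point is [None]. *)
pose K := one_point_compactification (discrete_topology (set nat)).
have [| | |nopen retr] := key K.
- split; first exact: one_point_compactification_compact.
  exact: one_point_compactification_discrete_hausdorff.
- move=> cK; apply: uncountable_set_nat.
  have /countable_injP[f finj] := cK.
  apply/countable_injP; exists (f \o Some) => A B _ _ /finj.
  by rewrite !inE => /(_ I I)[].
- exists None; split.
    move=> /isolated_setT; apply: not_isolated_none.
    by move=> /finite_set_countable/uncountable_set_nat.
  move=> [A|//] []; exact/isolated_setT/isolated_some.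
exact/nopen/retract_open.
Qed.
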